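(* Let $m$ be an integer with $m\ge 4$ and let $q,r\in\mathbb{N}$ (nonnegative integers) with $m=13q+r$ and $0\le r<13$. Then $$\frac{36m-50}{59}\le \sigma(m,3)\le 8q+2r\le \frac{8m}{13}+24.$$
   Context: For a permutation group $G$ on a finite set $\Omega$, $\alpha\in\Omega$ separates $\omega,\omega'\in\Omega$ if $\omega,\omega'$ lie in distinct orbits of the stabilizer $G_\alpha$; $S\subseteq\Omega$ is separating for $G$ if any two distinct elements of $\Omega$ are separated by some $\alpha\in S$; the orbit dimension of $G$ is the minimum cardinality of a separating set. $\sigma(m,k)$ denotes the orbit dimension of $\mathrm{Sym}(m)$ acting on the $k$-subsets of $\{1,\ldots,m\}$. Equivalently, $\sigma(m,k)$ is the minimum size of a family $S$ of $k$-subsets of $\{1,\ldots,m\}$ such that for any two distinct $k$-subsets $\omega,\omega'$ there is $\alpha\in S$ with $|\omega\cap\alpha|\ne|\omega'\cap\alpha|$; this is also the metric dimension of the Johnson graph $J(m,k)$. *)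

(* Defs.v *)
From mathcomp Require Import all_boot all_fingroup.

Set Implicit Arguments.
Unset Strict Implicit.
Unset Printing Implicit Defensive.

Local Open Scope group_scope.

Section OrbitDimension.

(* The group [G] acts through [to] on the set [Omega] of points of [T]. *)
Variables (aT : finGroupType) (T : finType) (to : {action aT &-> T}).
Variables (G : {set aT}) (Omega : {set T}).

Definition separates (a w w' : T) : bool :=
  orbit to 'C_G[a | to] w != orbit to 'C_G[a | to] w'.

Definition separating (S : {set T}) : bool :=
  (S \subset Omega) &&
  [forall w in Omega, forall w' in Omega,
     (w != w') ==> [exists a in S, separates a w w']].

(* [Omega] itself is separating (see [separating_full]), so the minimum is
   taken over a nonempty collection; [orbit_dimP] states its meaning. *)
Definition orbit_dim : nat := #|[arg min_(S < Omega | separating S) #|S|]%N|.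

End OrbitDimension.

Lemma separating_full (aT : finGroupType) (T : finType)
    (to : {action aT &-> T}) (G : {group aT}) (Omega : {set T}) :
  separating to G Omega Omega.
Proof.
rewrite /separating subxx /=.
apply/forall_inP => w wO; apply/forall_inP => w' w'O; apply/implyP => ww'.
apply/exists_inP; exists w => //; apply: contra ww' => /eqP e.
have : w' \in orbit to 'C_G[w | to] w by rewrite e orbit_refl.
case/orbitP => g /setIP[_ /astab1P gw] /=.
by rewrite gw => ->.
Qed.

Lemma orbit_dimP (aT : finGroupType) (T : finType)
    (to : {action aT &-> T}) (G : {group aT}) (Omega : {set T}) :
  (exists2 S, separating to G Omega S & #|S| = orbit_dim to G Omega) /\
  (forall S, separating to G Omega S -> (orbit_dim to G Omega <= #|S|)%N).
Proof.
rewrite /orbit_dim; case: arg_minnP => [|S0 S0sep S0min].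
  exact: separating_full.
by split; [exists S0 | exact: S0min].
Qed.

Definition ksubsets (m k : nat) : {set {set 'I_m}} :=
  [set A : {set 'I_m} | #|A| == k].

(* ['P^*] is the action of permutations on sets of points by direct image. *)
Definition sigma (m k : nat) : nat :=
  orbit_dim ('P^*)%act [set: 'S_m] (ksubsets m k).

(* Main.v *)
Require Import Defs.
From mathcomp Require Import all_boot all_fingroup all_algebra zify lra.
From Stdlib Require BinNat.

Set Implicit Arguments.
Unset Strict Implicit.
Unset Printing Implicit Defensive.

(** Two k-subsets w, w' are separated by a k-subset a exactly when
    #|w :&: a| <> #|w' :&: a| [separatesE].  So sigma m 3 is the least size of a
    set S of 3-subsets, called blocks, such that no two distinct triples of
    points meet every block in equally many points.  Encode a point v by its
    star, the set of blocks through v, seen as a 0-1 vector indexed by S: S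
    resolves when the sums of three distinct such vectors are all distinct.
    In this dual picture the blocks are nodes, a point of degree 1 is a mark on a
    node, a point of degree 2 is an edge between two nodes, a point of degree d
    is a hyperedge on d nodes, and each node lies in exactly three of these.

    Lower bound.  Small relations between the vectors are forbidden: a node has
    at most one mark; an unmarked node has at most one marked neighbour, since
    the edge to one marked neighbour plus the mark of the other gives the same
    sum after swapping the two; similar relations exclude that two hyperedges of
    three marked nodes share a node, and limit the paths of four edges between
    marked nodes.  A discharging argument turns this into a count: each point
    asks for 24 units from the blocks through it, with the shares of [pay], and
    no block is asked for more than 39 [block_pays].  At most one point receives
    less than 24 [one_underpaid].  Hence 8 * m <= 13 * #|S| + 8
    [discharging_bound] for m >= 5, which is stronger than the lower bound
    claimed and has the same leading constant 8 / 13 as the upper bound.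

    Upper bound.  Systems on disjoint point sets are put side by side.  A
    relation between triples of the union splits into relations inside the parts
    whose two sides need not have equal sizes; therefore all parts but one are
    taken to be [dissociating]: they separate not only triples, but also all
    sets of at most two points, whatever their sizes.  Every m is then a sum of
    a few part sizes: 26 points with 16 blocks, used repeatedly, and the small
    systems on 4 to 8 and on 13 points [resolving_exists].  That these few
    explicit systems have the stated properties is a finite computation.

    The bound 8 q + 2 r <= 8 m / 13 + 24 is arithmetic, as r <= 12. *)

(** * Separation by a stabilizer of a k-subset *)

Section Resolving.
Variable T : finType.
Implicit Types (S : {set {set T}}) (A B : {set T}).

Definition agree S A B := forall b, b \in S -> #|A :&: b| = #|B :&: b|.

Definition resolves k S :=
  forall A B, #|A| = k -> #|B| = k -> agree S A B -> A = B.

End Resolving.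

Lemma perm_of_fibers (n : nat) (C : eqType) (f g : 'I_n -> C) :
  (forall c, #|[pred i | f i == c]| = #|[pred i | g i == c]|) ->
  exists s : 'S_n, forall i, f i = g (s i).
Proof.
move=> fg.
have: perm_eq [tuple f i | i < n] [tuple g i | i < n].
  apply/allP => c _; rewrite /= !count_map -!size_filter.
  by have := fg c; rewrite !cardE /enum_mem -!enumT => ->.
move/tuple_permP => [s e]; exists s => i.
have: tnth [tuple f i | i < n] i =
      tnth [tuple tnth [tuple g i | i < n] (s i) | i < n] i.
  by congr tnth; apply: val_inj.
by rewrite !tnth_mktuple.
Qed.

(** The setwise stabilizer of a in the symmetric group is the product of the
    symmetric groups on a and on its complement, so its orbits on sets of a given
    size are told apart by the number of points in a.  The permutation for the
    converse matches the four cells cut out by a and w with those of a and w'. *)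
Lemma separatesE (m : nat) (a w w' : {set 'I_m}) : #|w| = #|w'| ->
  separates ('P^*)%act [set: 'S_m] a w w' = (#|w :&: a| != #|w' :&: a|).
Proof.
move=> ww'; rewrite /separates; congr negb; apply/eqP/eqP => [e|e].
  have: w' \in orbit ('P^*)%act ('C_([set: 'S_m])[a | ('P^*)%act])%g w.
    by rewrite e orbit_refl.
  case/orbitP => g /setIP[_ /astab1P /=] + /= <-.
  rewrite /setact => ga; rewrite -{2}ga -imsetI; last first.
    by move=> x y _ _; apply: perm_inj.
  by rewrite card_imset //; apply: perm_inj.
have [c|s sP] := @perm_of_fibers m _
  (fun i => (i \in w', i \in a)) (fun i => (i \in w, i \in a)).
  have fibre (p : {set 'I_m}) : #|[pred i | (i \in p, i \in a) == c]| =
      #|(if c.1 then p else ~: p) :&: (if c.2 then a else ~: a)|.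
    apply: eq_card => i; case: c => [c1 c2]; rewrite !inE xpair_eqE /=.
    by case: c1; case: c2; rewrite ?inE; case: (i \in p); case: (i \in a).
  have D1 (p : {set 'I_m}) : #|p :&: ~: a| = #|p| - #|p :&: a|.
    by rewrite -setDE cardsD.
  have D2 (p : {set 'I_m}) : #|~: p :&: a| = #|a| - #|p :&: a|.
    by rewrite setIC -setDE cardsD setIC.
  have D3 (p : {set 'I_m}) :
      #|~: p :&: ~: a| = #|'I_m| - (#|p| + #|a| - #|p :&: a|).
    by rewrite -setCU cardsCs setCK cardsU.
  by rewrite !fibre; case: c {fibre} => [[] []] /=; rewrite ?D3 ?D2 ?D1 ?ww' ?e.
have ws : s @: w' = w.
  apply/setP => i; apply/imsetP/idP => [[j jw' ->]|iw].
    by have [<- _] := sP j.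
  exists (s^-1%g i); last by rewrite permKV.
  by have [-> _] := sP (s^-1%g i); rewrite permKV.
have sa : s @: a = a.
  apply/eqP; rewrite eqEcard card_imset ?leqnn ?andbT; last exact: perm_inj.
  by apply/subsetP => _ /imsetP[j ja ->]; have [_ <-] := sP j.
apply/orbit_eqP/orbitP; exists s => //.
by apply/setIP; split; [rewrite inE | apply/astab1P].
Qed.

(** * The lower bound by discharging *)

Lemma mem_eq (T : finType) (A B : {set T}) x : A = B -> (x \in A) = (x \in B).
Proof. by move->. Qed.

(** Incidences are generalized to arbitrary numbers: the identities between sums
    of incidence vectors hold term by term, with no case analysis on booleans. *)
Ltac bool_lia :=
  repeat match goal with
  | |- context [nat_of_bool ?b] => move: (nat_of_bool b) => ?
  end;
  clear; lia.

Section LowerBound.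
Variables (V : finType) (S : {set {set V}}).
Hypothesis card_block : {in S, forall b : {set V}, #|b| = 3}.
Hypothesis resS : resolves 3 S.
Implicit Types (v x y : V) (b c : {set V}).

Lemma card_triple x y z : uniq [:: x; y; z] -> #|[set x; y; z]| = 3.
Proof.
move=> u; rewrite -[3]/(size [:: x; y; z]) -(card_uniqP u); apply: eq_card => i.
by rewrite !inE orbA.
Qed.

Lemma card_tripleI x y z b : uniq [:: x; y; z] ->
  #|[set x; y; z] :&: b| = (x \in b) + (y \in b) + (z \in b).
Proof.
move=> u; have -> : #|[set x; y; z] :&: b| = count (mem b) [:: x; y; z].
  rewrite -size_filter -(card_uniqP (filter_uniq _ u)); apply: eq_card => i.
  by rewrite mem_filter !inE orbA andbC.
by rewrite /= addn0 addnA.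
Qed.

(** The form in which resolving is used: a linear relation between the incidence
    vectors of two triples forces the triples to be equal.  Only a common point
    is recorded, because every application exhibits an x1 outside the y's. *)
Lemma triple_relation_trivial x1 x2 x3 y1 y2 y3 :
    uniq [:: x1; x2; x3] -> uniq [:: y1; y2; y3] ->
    (forall b, b \in S -> (x1 \in b) + (x2 \in b) + (x3 \in b) =
                          (y1 \in b) + (y2 \in b) + (y3 \in b)) ->
  x1 \in [:: y1; y2; y3].
Proof.
move=> ux uy xy.
have: [set x1; x2; x3] = [set y1; y2; y3].
  by apply: resS; rewrite ?card_triple // => b bS; rewrite !card_tripleI ?xy.
by move/setP/(_ x1); rewrite !inE eqxx /= orbA => <-.
Qed.

(** A fifth point is added to both sides to reduce to triples. *)
Lemma pair_relation_trivial x1 x2 y1 y2 : 4 < #|V| ->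
    uniq [:: x1; x2] -> uniq [:: y1; y2] ->
    (forall b, b \in S -> (x1 \in b) + (x2 \in b) = (y1 \in b) + (y2 \in b)) ->
  x1 \in [:: y1; y2].
Proof.
move=> V5 ux uy xy; set s := [:: x1; x2; y1; y2].
have /existsP[e es] : [exists e, e \notin s].
  rewrite -negb_forall; apply: contraL V5 => /forallP sV; rewrite -leqNgt.
  apply: leq_trans (card_size s); apply/subset_leq_card/subsetP => e _.
  exact: sV.
move: es ux uy; rewrite /= !inE !negb_or !andbT => /and4P[x1e x2e y1e y2e] ux uy.
have := @triple_relation_trivial x1 x2 e y1 y2 e.
rewrite /= !inE !negb_or !andbT ux uy ![_ == e]eq_sym x1e x2e y1e y2e.
by rewrite (negPf x1e) !orbF; apply => // b /xy->.
Qed.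

Definition star v := [set b in S | v \in b].

Lemma star_inj : 3 < #|V| -> injective star.
Proof.
move=> V4 x y sxy; apply/eqP/negPn/negP => xy.
have: 1 < #|~: [set x; y]|.
  by rewrite cardsCs setCK cards2 xy; lia.
case/card_gt1P => c [d []]; rewrite !inE !negb_or => /andP[cx cy] /andP[dx dy] cd.
have := @triple_relation_trivial x c d y c d.
rewrite /= !inE !negb_or cd !andbT ![_ == c]eq_sym ![_ == d]eq_sym cx cy dx dy.
rewrite (negPf xy) (negPf cx) (negPf dx) /=.
move=> /(_ isT isT) F; suff: false by []; apply: F => b bS.
by have := mem_eq b sxy; rewrite !inE bS /= => ->.
Qed.

Definition deg v := #|star v|.

Lemma star_mem v b : b \in S -> (b \in star v) = (v \in b).
Proof. by move=> bS; rewrite inE bS. Qed.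

Lemma deg_neq x y : deg x != deg y -> x != y.
Proof. by apply: contra_neq => ->. Qed.

Lemma star1_mem v b c : star v = [set b] -> c \in S -> (v \in c) = (c == b).
Proof. by move=> sv cS; rewrite -star_mem // sv inE. Qed.

Lemma star2_mem v b b' c : star v = [set b; b'] -> b != b' -> c \in S ->
  (v \in c) = (c == b) + (c == b') :> nat.
Proof.
move=> sv bb' cS; rewrite -star_mem // sv !inE.
by case: (eqVneq c b) bb' => [->|_] //=; case: eqP.
Qed.

Lemma star3_mem v b b' b'' c : star v = [set b; b'; b''] ->
    uniq [:: b; b'; b''] -> c \in S ->
  (v \in c) = (c == b) + (c == b') + (c == b'') :> nat.
Proof.
move=> sv /=; rewrite !inE negb_or andbT => /andP[/andP[b1 b2] b3] cS.
rewrite -star_mem // sv !inE.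
case: (eqVneq c b) b1 b2 => [->|_] /=; first by do 2!case: eqP.
by case: (eqVneq c b') b3 => [->|_] //= ; case: eqP.
Qed.

(** A block is marked when it carries the mark of the dual picture: a point
    lying in no other block. *)
Definition marked b := [exists v in b, deg v == 1].

Lemma mark_of b : b \in S -> marked b -> exists2 v, deg v = 1 & star v = [set b].
Proof.
move=> bS /exists_inP[v vb /eqP dv]; exists v => //.
move/eqP/cards1P: (dv) => [c sv]; rewrite sv; congr set1.
by apply/eqP; rewrite eq_sym -(star1_mem sv).
Qed.

(** For a point v of degree 2, [star v :\ b] is the other block through v, the
    mate of b along v; stating the property of the mate by an existential keeps
    it defined for all v and b. *)
Definition mate (P : pred {set V}) v b := [exists c in star v :\ b, P c].

Lemma mateE (P : pred {set V}) v b c : star v = [set b; c] -> b != c ->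
  mate P v b = P c.
Proof.
move=> sv bc; apply/exists_inP/idP => [[d]|Pc].
  by rewrite sv !inE => /andP[/negPf->] /= /eqP->.
by exists c; rewrite // sv !inE eqxx orbT andbT eq_sym.
Qed.

Lemma star2_of v b : b \in S -> v \in b -> deg v = 2 ->
  exists c, [/\ c \in S, b != c & star v = [set b; c]].
Proof.
move=> bS vb /eqP/cards2P[c [d [cd sv]]].
have: b \in star v by rewrite star_mem.
have cS : c \in S by have := mem_eq c sv; rewrite !inE eqxx; case/andP.
have dS : d \in S by have := mem_eq d sv; rewrite !inE eqxx orbT; case/andP.
rewrite sv !inE => /orP[]/eqP->; first by exists d.
by exists c; rewrite eq_sym cd setUC.
Qed.

Definition near b :=
  ~~ marked b && [exists v in b, (deg v == 2) && mate marked v b].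

(** The points whose demand of 24 is not met by [pay].  In the dual picture they
    are the zero vector and the edges between two marked nodes. *)
Definition underpaid v :=
  (deg v == 0) || (deg v == 2) && [forall b in star v, marked b].

(** The share of the demand of v that is put on the block b.  The constants form a
    feasible dual solution of the linear program that maximizes the number of
    points for a given number of blocks, scaled so that a point is worth 24 and
    a block 39.  The relations between small sets of points allow, per block:
    - marked: one mark (24), one point in three marked blocks (8), the rest 7;
    - near: one point leading to a marked block (17), one leading to a near
      block (12), the rest at most 10;
    - other: one point leading to a near block (14), the rest at most 12.
    Each row adds up to at most 39. *)
Definition pay b v : nat :=
  match deg v with
  | 0 => 0
  | 1 => 24
  | 2 => if marked b then 7
         else if mate marked v b then 17
         else if near b then if mate near v b then 12 else 10
         else if mate near v b then 14 else 12
  | 3 => if marked b then if [forall c in star v, marked c] then 8 else 7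
         else 10
  | _ => 7
  end.

Lemma vertex_paid v : ~~ underpaid v -> 24 <= \sum_(b in star v) pay b v.
Proof.
rewrite /underpaid negb_or => /andP[].
case dv : (deg v) => [|[|[|[|d]]]] //= _.
- by have [b ->] := cards1P (introT eqP dv); rewrite big_set1 /pay dv.
- move=> /forall_inPn[b0 b0v m0] .
  move: (b0v); rewrite inE => /andP[b0S vb0].
  have [c [cS b0c sv]] := star2_of b0S vb0 dv.
  have vc : v \in c by rewrite -star_mem // sv !inE eqxx orbT.
  rewrite sv big_setU1 ?inE // big_set1 /pay dv.
  have mb := fun P => mateE P sv b0c.
  have mc P : mate P v c = P b0 by apply: mateE; rewrite 1?setUC // eq_sym.
  rewrite !mb !mc (negPf m0).
  case mc0 : (marked c) => //.
  by case nb : (near b0); case nc : (near c).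
- move=> _.
  have [a [b [c [abc sv]]]] :
      exists a b c, uniq [:: a; b; c] /\ star v = [set a; b; c].
    have := enum_uniq (mem (star v)); have := cardE (mem (star v)).
    rewrite -/(deg v) dv; case e : (enum _) => [|a [|b [|c [|]]]] // _ u.
    exists a, b, c; split => //; apply/setP => i.
    by rewrite -(mem_enum (mem (star v))) e !inE orbA.
  have -> : \sum_(b in star v) pay b v = pay a v + pay b v + pay c v.
    move: abc; rewrite sv /= !inE negb_or andbT => /andP[/andP[ab ac] bc].
    rewrite -setUA big_setU1 ?inE ?negb_or ?ab // big_setU1 ?inE // big_set1.
    by rewrite /= addnA.
  have allm : [forall d in star v, marked d] = [&& marked a, marked b & marked c].
    apply/forall_inP/and3P => [h|[ma mb mc] d].
      by split; apply: h; rewrite sv !inE eqxx ?orbT.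
    by rewrite sv !inE => /orP[/orP[]|] /eqP->.
  by rewrite /pay dv allm; case: (marked a); case: (marked b); case: (marked c).
- move=> _; rewrite (eq_bigr (fun => 7)); last by move=> b _; rewrite /pay dv.
  by rewrite sum_nat_const -/(deg v) dv; lia.
Qed.

Lemma at_most_one b (P : pred V) :
  {in b &, forall x y, P x -> P y -> x = y} -> \sum_(v in b) P v <= 1.
Proof.
move=> h; rewrite -big_mkcondr sum1_card; apply/card_le1_eqP => x y.
by rewrite !unfold_in => /andP[xb Px] /andP[yb Py]; apply: h.
Qed.

(** Every block type has a common base share k, exceeded only by at most one
    point for each of two reasons P and Q. *)
Lemma block_budget b (k p q : nat) (P Q : pred V) : b \in S ->
    {in b, forall v, pay b v <= k + p * P v + q * Q v} ->
    {in b &, forall x y, P x -> P y -> x = y} ->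
    {in b &, forall x y, Q x -> Q y -> x = y} ->
  \sum_(v in b) pay b v <= 3 * k + p + q.
Proof.
move=> bS le_pay /at_most_one P1 /at_most_one Q1.
apply: (@leq_trans (\sum_(v in b) (k + p * P v + q * Q v))).
  by apply: leq_sum => v; apply: le_pay.
rewrite !big_split /= sum_nat_const card_block // -!big_distrr /=.
by rewrite leq_add ?leq_add // -[X in _ <= X]muln1 leq_mul2l ?P1 ?Q1 orbT.
Qed.

Hypothesis V5 : 4 < #|V|.

Let V4 : 3 < #|V| := ltnW V5.

Lemma one_mark b : b \in S ->
  {in b &, forall x y, deg x == 1 -> deg y == 1 -> x = y}.
Proof.
move=> bS x y xb yb /cards1P[c sx] /cards1P[d sy]; apply: (star_inj V4).
rewrite sx sy; move: xb yb.
by rewrite (star1_mem sx) // (star1_mem sy) // => /eqP<- /eqP<-.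
Qed.

Definition all_marked v := (deg v == 3) && [forall c in star v, marked c].

(** If x lies in b, c, d and y in b, c', d', all of them marked, then x together
    with the marks of c' and d' has the same incidences as y together with the
    marks of c and d. *)
Lemma one_all_marked b : b \in S ->
  {in b &, forall x y, all_marked x -> all_marked y -> x = y}.
Proof.
move=> bS.
have all_markedP x : x \in b -> all_marked x ->
    exists m n, [/\ deg x = 3, deg m = 1, deg n = 1, m != n & forall c,
      c \in S -> (x \in c) = (c == b) + (m \in c) + (n \in c) :> nat].
  move=> xb /andP[/eqP dx /forall_inP ms].
  have : #|star x :\ b| == 2.
    have := cardsD1 b (star x); rewrite -/(deg x) dx star_mem // xb add1n => /eqP.
    by rewrite eqSS eq_sym.
  case/cards2P => c [d [cd sx]].
  have sx3 : star x = [set b; c; d] by rewrite -setUA -sx setD1K ?star_mem.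
  have [cx dx'] : c \in star x :\ b /\ d \in star x :\ b.
    by rewrite sx !inE !eqxx orbT.
  have [bc cx'] := setD1P cx; have [bd dx''] := setD1P dx'.
  have cS : c \in S by move: cx'; rewrite inE => /andP[].
  have dS : d \in S by move: dx''; rewrite inE => /andP[].
  have [m dm sm] := mark_of cS (ms _ cx').
  have [n dn sn] := mark_of dS (ms _ dx'').
  exists m, n; split=> //.
    by apply: contra_neq cd => mn; apply: set1_inj; rewrite -sm -sn mn.
  move=> e eS; rewrite (star1_mem sm) // (star1_mem sn) // (star3_mem sx3) //.
  by rewrite /= !inE negb_or cd ![b == _]eq_sym bc bd.
move=> x y xb yb fx fy.
have [m [n [dx dm dn mn xE]]] := all_markedP x xb fx.
have [m' [n' [dy dm' dn' mn' yE]]] := all_markedP y yb fy.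
have := @triple_relation_trivial x m' n' y m n.
rewrite /= !inE !negb_or mn mn' (deg_neq (x := x) (y := m')) ?dx ?dm' //.
rewrite (deg_neq (x := x) (y := n')) ?dx ?dn' //.
rewrite (deg_neq (x := y) (y := m)) ?dy ?dm //.
rewrite (deg_neq (x := y) (y := n)) ?dy ?dn //.
case/(_ isT isT _)/or3P => [c cS||/eqP e|/eqP e].
- by rewrite xE // yE //; bool_lia.
- by move/eqP.
- by move: dx; rewrite e dm.
- by move: dx; rewrite e dn.
Qed.

Definition marked_mate b v := (deg v == 2) && mate marked v b.

Lemma marked_mateP b x : b \in S -> x \in b -> marked_mate b x ->
  exists m c, [/\ deg x = 2, deg m = 1, star x = [set b; c], star m = [set c]
    & [/\ marked c, c \in S & b != c]].
Proof.
move=> bS xb /andP[/eqP dx].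
have [c [cS bc sx]] := star2_of bS xb dx.
rewrite (mateE _ sx) // => mc; have [m dm sm] := mark_of cS mc.
by exists m, c.
Qed.

(** If x joins b to c and y joins b to d, with c and d marked, then x together
    with the mark of d has the same incidences as y together with the mark
    of c. *)
Lemma one_marked_mate b : b \in S ->
  {in b &, forall x y, marked_mate b x -> marked_mate b y -> x = y}.
Proof.
move=> bS x y xb yb.
case/(marked_mateP bS xb) => [m [c [dx dm sx sm [_ cS bc]]]].
case/(marked_mateP bS yb) => [n [d [dy dn sy sn [_ dS bd]]]].
have := @pair_relation_trivial x n y m V5.
rewrite /= !inE !andbT (deg_neq (x := x) (y := n)) ?dx ?dn //.
rewrite (deg_neq (x := y) (y := m)) ?dy ?dm //.
case/(_ isT isT _)/orP => [e eS||/eqP e]; last by move: dx; rewrite e dm.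
  rewrite (star2_mem sx) // (star2_mem sy) // (star1_mem sm) // (star1_mem sn) //.
  by bool_lia.
by move/eqP.
Qed.

Definition near_mate b v := (deg v == 2) && mate near v b.

(** In the dual picture, two such points x and y are the middle edges of a path
    d - c - b - c' - d' whose ends d and d' are marked, and whose outer edges are
    w and w'.  Alternate edges of the path, completed by the marks of the ends,
    are two triples with the same incidences.  If d = d' then the marks coincide
    and the path closes up to a 4-cycle; the triples are still distinct. *)
Lemma one_near_mate b : b \in S -> ~~ marked b ->
  {in b &, forall x y, near_mate b x -> near_mate b y -> x = y}.
Proof.
move=> bS ub.
have nearP x : x \in b -> near_mate b x -> exists c w d m,
   [/\ deg x = 2, deg m = 1, star x = [set b; c], star w = [set c; d]
     & star m = [set d]] /\
   [/\ deg w = 2, ~~ marked c, marked d, b != c & c != d].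
  move=> xb /andP[/eqP dx]; have [c [cS bc sx]] := star2_of bS xb dx.
  rewrite (mateE _ sx) // => /andP[uc] /exists_inP[w wc].
  case/(marked_mateP cS wc) => [m [d [dw dm sw sm [md dS cd]]]].
  by exists c, w, d, m.
move=> x y xb yb.
case/(nearP x xb) => c [w [d [m [[dx dm sx sw sm] [dw uc md bc cd]]]]].
case/(nearP y yb) => c' [w' [d' [m' [[dy dm' sy sw' sm'] [dw' uc' md' bc' cd']]]]].
have diff v e f u e' : star v = [set b; e] -> star u = [set e'; f] ->
    ~~ marked e -> marked f -> v != u.
  move=> sv su ue mf; apply/eqP => vu; have := mem_eq f sv.
  rewrite vu su !inE eqxx orbT => /esym/orP[]/eqP fe.
    by rewrite -fe mf in ub.
  by rewrite -fe mf in ue.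
have := @triple_relation_trivial x w' m y w m'.
rewrite /= !inE !negb_or !andbT.
rewrite (diff _ _ _ _ _ sx sw' uc md') (diff _ _ _ _ _ sy sw uc' md).
rewrite (deg_neq (x := x) (y := m)) ?dx ?dm //.
rewrite (deg_neq (x := w') (y := m)) ?dw' ?dm //.
rewrite (deg_neq (x := y) (y := m')) ?dy ?dm' //.
rewrite (deg_neq (x := w) (y := m')) ?dw ?dm' //.
rewrite (negPf (diff _ _ _ _ _ sx sw uc md)).
rewrite (negPf (deg_neq (x := x) (y := m') _)) ?dx ?dm' //.
rewrite !orbF => /(_ isT isT) F; apply/eqP/F => e eS.
rewrite (star2_mem sx) // (star2_mem sy) // (star2_mem sw) // (star2_mem sw') //.
by rewrite (star1_mem sm) // (star1_mem sm') //; bool_lia.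
Qed.

Lemma block_pays b : b \in S -> \sum_(v in b) pay b v <= 39.
Proof.
move=> bS; case mb : (marked b).
  apply: (block_budget (k := 7) (p := 17) (q := 1) bS _
    (one_mark bS) (one_all_marked bS)).
  move=> v vb; rewrite /all_marked /pay mb.
  by case: (deg v) => [|[|[|[|]]]] //=; case: ifP.
case nb : (near b).
  apply: (block_budget (k := 10) (p := 7) (q := 2) bS _
    (one_marked_mate bS) (one_near_mate bS (negbT mb))).
  move=> v vb; rewrite /marked_mate /near_mate /pay mb nb.
  have : deg v != 1 by apply: contraFN mb => dv; apply/exists_inP; exists v.
  case: (deg v) => [|[|[|[|]]]] //= _.
  by case: (mate marked v b); case: (mate near v b).
apply: (@leq_trans (3 * 12 + 2 + 0)) => //.
apply: (block_budget (P := near_mate b) (Q := pred0) bS) => //;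
  last exact: one_near_mate (negbT mb).
move=> v vb; rewrite /near_mate /pay mb nb.
have : deg v != 1 by apply: contraFN mb => dv; apply/exists_inP; exists v.
case dv: (deg v) => [|[|[|[|]]]] //= _.
have -> : mate marked v b = false.
  apply: contraFF nb => mv; rewrite /near mb; apply/exists_inP; exists v => //.
  by rewrite dv.
by case: ifP.
Qed.

(** An edge between two marked nodes is the sum of the two marks.  Two such
    relations, each with one side longer by one point, combine into a relation
    between triples; one such relation and the zero vector combine into one
    between pairs. *)
Lemma one_underpaid x y : underpaid x -> underpaid y -> x = y.
Proof.
have bad0 v : deg v == 0 -> star v = set0 by move/eqP/cards0_eq.
have bad2 v : (deg v == 2) && [forall b in star v, marked b] ->
    exists m n, [/\ deg v = 2, deg m = 1, deg n = 1, m != n &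
      forall b, b \in S -> (v \in b) = (m \in b) + (n \in b) :> nat].
  case/andP => dv2 /forall_inP ms; have /eqP dv := dv2.
  have /cards2P[c [d [cd sv]]] := dv2.
  have cv : c \in star v by rewrite sv !inE eqxx.
  have dv' : d \in star v by rewrite sv !inE eqxx orbT.
  have cS : c \in S by move: cv; rewrite inE => /andP[].
  have dS : d \in S by move: dv'; rewrite inE => /andP[].
  have [m dm sm] := mark_of cS (ms _ cv).
  have [n dn sn] := mark_of dS (ms _ dv').
  exists m, n; split => //.
    by apply: contra_neq cd => mn; apply: set1_inj; rewrite -sm -sn mn.
  by move=> b bS; rewrite (star2_mem sv) // (star1_mem sm) // (star1_mem sn).
have bad02 u v : deg u == 0 ->
    (deg v == 2) && [forall b in star v, marked b] -> False.
  move=> du /bad2[m [n [dv dm dn mn vE]]]; have su := bad0 _ du.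
  move/eqP: du => du.
  have := @pair_relation_trivial u v m n V5.
  rewrite /= !inE !andbT mn (deg_neq (x := u) (y := v)) ?du ?dv //.
  rewrite (negPf (deg_neq (x := u) (y := m) _)) ?du ?dm //.
  rewrite (negPf (deg_neq (x := u) (y := n) _)) ?du ?dn //.
  move=> /(_ isT isT) F; suff: false by []; apply: F => b bS.
  by rewrite -vE // -star_mem // su inE.
move=> /orP[x0|x2] /orP[y0|y2].
- by apply: (star_inj V4); rewrite !bad0.
- by have := bad02 _ _ x0 y2.
- by have := bad02 _ _ y0 x2.
have [m [n [dx dm dn mn xE]]] := bad2 _ x2.
have [m' [n' [dy dm' dn' mn' yE]]] := bad2 _ y2.
have := @triple_relation_trivial x m' n' y m n.
rewrite /= !inE !negb_or mn mn' !andbT.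
rewrite (deg_neq (x := x) (y := m')) ?dx ?dm' //.
rewrite (deg_neq (x := x) (y := n')) ?dx ?dn' //.
rewrite (deg_neq (x := y) (y := m)) ?dy ?dm //.
rewrite (deg_neq (x := y) (y := n)) ?dy ?dn //.
rewrite (negPf (deg_neq (x := x) (y := m) _)) ?dx ?dm //.
rewrite (negPf (deg_neq (x := x) (y := n) _)) ?dx ?dn //.
rewrite !orbF => /(_ isT isT) F; apply/eqP/F => b bS.
by rewrite xE // yE //; bool_lia.
Qed.

Lemma discharging_bound : 8 * #|V| <= 13 * #|S| + 8.
Proof.
have total : \sum_v \sum_(b in star v) pay b v <= 39 * #|S|.
  rewrite (exchange_big_dep (mem S)) /=; last first.
    by move=> v b _; rewrite inE => /andP[].
  rewrite mulnC -sum_nat_const; apply: leq_sum => b bS.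
  rewrite (eq_bigl (mem b)) ?block_pays // => v.
  by rewrite star_mem.
have bad1 : \sum_v (underpaid v : nat) <= 1.
  rewrite (eq_bigl (mem [set: V])); last by move=> v; rewrite /= inE.
  by apply: at_most_one => x y _ _; apply: one_underpaid.
have : \sum_(v : V) 24 <= \sum_v (\sum_(b in star v) pay b v + 24 * underpaid v).
  apply: leq_sum => v _; case bv : (underpaid v); first by rewrite muln1 leq_addl.
  by rewrite (leq_trans (vertex_paid (negbT bv))) // leq_addr.
have -> : \sum_(v : V) 24 = 24 * #|V| by rewrite sum_nat_const mulnC.
rewrite big_split /= -big_distrr /=.
move: total bad1; set t := \sum_v _; set u := \sum_v _; clearbody t u.
by clear; move: t u #|V| #|S| => *; lia.
Qed.

End LowerBound.

(** * Disjoint unions of block systems *)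

Section Systems.
Variable T : finType.
Implicit Types (S : {set {set T}}) (A B : {set T}).

(** The last two conditions, which go beyond separating triples, are what the
    trace of a larger system on one part has to satisfy. *)
Definition resolving_triples S := [/\ {in S, forall b : {set T}, #|b| = 3},
  forall x, exists2 b, b \in S & x \in b & forall k, k <= 3 -> resolves k S].

(** Besides equal sizes, this forbids that two points have the same incidences as
    one point.  The forbidden relation may occur in one part of a union, but a
    second part where it occurs would let the two sides be balanced.  A relation
    of one or two points with three points may occur in every part: the three
    points are one whole triple, so in the other parts the rest of the opposite
    triple would have to avoid all blocks. *)
Definition dissociating S := [/\ {in S, forall b : {set T}, #|b| = 3},
  forall A B, #|A| <= 2 -> #|B| <= 2 -> agree S A B -> A = B & resolves 3 S].

Lemma dissociating_covers S x : dissociating S -> exists2 b, b \in S & x \in b.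
Proof.
case=> _ small _; apply/exists_inP; apply: contraT => /exists_inPn noS.
suff /setP/(_ x) : [set x] = set0 by rewrite !inE eqxx.
apply: small => [||b bS]; rewrite ?cards1 ?cards0 // set0I cards0.
by apply/eqP; rewrite cards_eq0; apply/eqP/disjoint_setI0; rewrite disjoints1 noS.
Qed.

Lemma dissociating_resolving S : dissociating S -> resolving_triples S.
Proof.
move=> sS; have [b3 small res3] := sS; split=> // [x|k].
  exact: dissociating_covers.
rewrite leq_eqVlt => /orP[/eqP-> //|k2] A B kA kB; apply: small.
  by rewrite kA.
by rewrite kB.
Qed.

Lemma agree_set0 S A : (forall x, exists2 b, b \in S & x \in b) ->
  agree S A set0 -> A = set0.
Proof.
move=> cov A0; apply/eqP; rewrite -subset0; apply/subsetP => x xA.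
have [b bS xb] := cov x; have := A0 b bS; rewrite set0I cards0 => /eqP.
by rewrite cards_eq0 => /eqP/setP/(_ x); rewrite !inE xA xb.
Qed.

Lemma agreeC S A B : agree S A B -> agree S B A.
Proof. by move=> AB b /AB. Qed.

End Systems.

Lemma card_imsetI (T1 T : finType) (f : T1 -> T) (A : {set T}) (b : {set T1}) :
  injective f -> #|A :&: f @: b| = #|(f @^-1: A) :&: b|.
Proof.
move=> injf; rewrite -(card_imset _ injf); apply: eq_card => z; rewrite !inE.
apply/andP/imsetP => [[zA /imsetP[x xb zx]]|[x]].
  by exists x; rewrite // !inE -zx zA.
by rewrite !inE => /andP[xA xb] ->; rewrite xA imset_f.
Qed.

Section Union.
Variables (T1 T2 T : finType) (f : T1 -> T) (g : T2 -> T).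
Hypotheses (injf : injective f) (injg : injective g).
Hypotheses (fg : forall x y, f x != g y)
  (cov : forall z, z \in codom f \/ z \in codom g).
Variables (S1 : {set {set T1}}) (S2 : {set {set T2}}).

Definition join : {set {set T}} :=
  (fun b : {set T1} => f @: b) @: S1 :|: (fun b : {set T2} => g @: b) @: S2.

(** Let A and B have the same size at most 3 and the same incidences.  If their
    traces on the second part both have at most two points, or both have three,
    these traces agree.  If only one of them, say that of A, has three points,
    then A misses the first part, hence so does B, and the sizes differ.  So the
    traces on the second part are equal, those on the first part have equal
    size, and the first part resolves them. *)
Lemma resolving_join :
  resolving_triples S1 -> dissociating S2 -> resolving_triples join.
Proof.
move=> [b1 c1 r1] s2; have [b2 small r2] := s2; split.
- by move=> _ /setUP[]/imsetP[b bS ->]; rewrite card_imset ?b1 ?b2.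
- move=> z; case: (cov z) => /codomP[x ->].
    have [b bS xb] := c1 x; exists (f @: b); last exact: imset_f.
    by rewrite inE; apply/orP; left; apply/imsetP; exists b.
  have [b bS xb] := dissociating_covers x s2; exists (g @: b); last exact: imset_f.
  by rewrite inE; apply/orP; right; apply/imsetP; exists b.
have decomp (A : {set T}) : A = f @: (f @^-1: A) :|: g @: (g @^-1: A).
  apply/setP => z; rewrite inE; apply/idP/orP => [zA|[]/imsetP[x]]; last 2 first.
  - by rewrite inE => ? ->.
  - by rewrite inE => ? ->.
  by case: (cov z) zA => /codomP[x ->] xA; [left|right]; rewrite imset_f ?inE.
have cardfg (A : {set T}) : #|A| = #|f @^-1: A| + #|g @^-1: A|.
  rewrite {1}[A]decomp cardsU !card_imset // (_ : _ :&: _ = set0) ?cards0 ?subn0 //.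
  apply/setP => z; rewrite !inE; apply/andP => -[/imsetP[x _ ->] /imsetP[y _ /eqP]].
  by rewrite (negPf (fg x y)).
move=> k k3 A B; rewrite !cardfg => kA kB AB.
have AB1 : agree S1 (f @^-1: A) (f @^-1: B).
  move=> b bS; rewrite -!(card_imsetI _ _ injf); apply: AB.
  rewrite inE; apply/orP; left.
  by apply/imsetP; exists b.
have AB2 : agree S2 (g @^-1: A) (g @^-1: B).
  move=> b bS; rewrite -!(card_imsetI _ _ injg); apply: AB.
  rewrite inE; apply/orP; right.
  by apply/imsetP; exists b.
have alone (X Y : {set T}) : #|f @^-1: X| + #|g @^-1: X| = k ->
    #|f @^-1: Y| + #|g @^-1: Y| = k -> agree S1 (f @^-1: X) (f @^-1: Y) ->
    3 <= #|g @^-1: X| -> 3 <= #|g @^-1: Y|.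
  move=> kX kY XY X3; have X0 : f @^-1: X = set0 by apply/cards0_eq; lia.
  have Y0 : f @^-1: Y = set0 by apply: (agree_set0 c1); rewrite -X0; apply: agreeC.
  by move: kX kY; rewrite X0 Y0 cards0; lia.
have e2 : g @^-1: A = g @^-1: B.
  case: (leqP 3 #|g @^-1: A|) => A3.
    by have B3 := alone A B kA kB AB1 A3; apply: r2 AB2; lia.
  case: (leqP 3 #|g @^-1: B|) => B3; last exact: small.
  by have := alone B A kB kA (agreeC AB1) B3; rewrite leqNgt A3.
have e1 : f @^-1: A = f @^-1: B.
  by apply: (r1 _ _ _ _ (erefl _) _ AB1); move: kA kB; rewrite e2; lia.
by rewrite [A]decomp [B]decomp e1 e2.
Qed.

Lemma card_join : #|join| <= #|S1| + #|S2|.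
Proof.
by rewrite cardsU (leq_trans (leq_subr _ _)) // leq_add ?leq_imset_card.
Qed.

End Union.

Definition has_resolving n k :=
  exists S : {set {set 'I_n}}, resolving_triples S /\ #|S| <= k.
Definition has_dissociating n k :=
  exists S : {set {set 'I_n}}, dissociating S /\ #|S| <= k.

Lemma has_resolvingD m n k l :
  has_resolving m k -> has_dissociating n l -> has_resolving (m + n) (k + l).
Proof.
move=> [S [wS kS]] [S' [sS lS]].
exists (join (@lshift m n) (@rshift m n) S S'); split; last first.
  by apply: leq_trans (card_join _ _ _ _) _; rewrite leq_add.
apply: resolving_join => //; [exact: lshift_inj | exact: rshift_inj | |].
  by move=> x y; rewrite eq_lrshift.
move=> z; case: (splitP z) => j e; [left|right].
  by apply/codomP; exists j; apply: val_inj.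
by apply/codomP; exists j; apply: val_inj.
Qed.

(** * Checking explicit systems by computation *)

Fixpoint subseqs (k : nat) (s : seq nat) : seq (seq nat) :=
  match k, s with
  | 0, _ => [:: [::]]
  | k'.+1, [::] => [::]
  | k'.+1, x :: s' => [seq x :: t | t <- subseqs k' s'] ++ subseqs k s'
  end.

Lemma subseqs_complete k s t : subseq t s -> size t = k -> t \in subseqs k s.
Proof.
elim: s k t => [|x s IH] [|k] [|y t] //= ; rewrite ?mem_seq1 //.
case: eqP => [->|_] ts [tk]; rewrite mem_cat; apply/orP.
  by left; apply: map_f; apply: IH.
by right; apply: IH => //=; rewrite tk.
Qed.

Lemma uniq_map_inj (T1 T2 : eqType) (f : T1 -> T2) s :
  uniq (map f s) -> {in s &, injective f}.
Proof.
elim: s => //= x s IH /andP[xs us] y z; rewrite !inE.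
case/predU1P=> [->|ys] /predU1P[->|zs] // fe; last exact: IH.
  by rewrite fe map_f in xs.
by rewrite -fe map_f in xs.
Qed.

(** The list of incidence numbers, packed as digits in base 4 of one binary number
    so that comparing and sorting profiles is cheap. *)
Definition profile (K : seq (seq nat)) (t : seq nat) : BinNums.N :=
  foldr (fun b c => BinNat.N.add (BinNat.N.of_nat (count (mem b) t))
                                 (BinNat.N.double (BinNat.N.double c)))
    BinNums.N0 K.

Definition distinct (s : seq BinNums.N) : bool :=
  sorted BinNat.N.ltb (sort BinNat.N.leb s).

Lemma distinct_uniq s : distinct s -> uniq s.
Proof.
rewrite -(sort_uniq BinNat.N.leb); apply: sorted_uniq => [y x z|x].
  move=> /BinNat.N.ltb_spec0 xy /BinNat.N.ltb_spec0 yz.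
  by apply/BinNat.N.ltb_spec0; apply: BinNat.N.lt_trans yz.
exact: BinNat.N.ltb_irrefl.
Qed.

Definition triples n (K : seq (seq nat)) : bool :=
  all (fun b => count (mem b) (iota 0 n) == 3) K.

Definition profiles n K k := map (profile K) (subseqs k (iota 0 n)).

Definition check_dissociating n K : bool :=
  [&& triples n K, distinct (profiles n K 3)
    & distinct (profiles n K 0 ++ profiles n K 1 ++ profiles n K 2)].

Definition check_resolving n K : bool :=
  [&& triples n K, distinct (profiles n K 3), distinct (profiles n K 2),
    distinct (profiles n K 1)
  & all (fun x => has (fun b => x \in b) K) (iota 0 n)].

Section Check.
Variables (n : nat) (K : seq (seq nat)).

Definition block (b : seq nat) : {set 'I_n} := [set i : 'I_n | val i \in b].
Definition blocks : {set {set 'I_n}} := [set b in map block K].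

Definition elements (A : {set 'I_n}) : seq nat := map val (enum A).

Lemma elements_inj : injective elements.
Proof.
move=> A B /(inj_map val_inj) AB; apply/setP => i.
by rewrite -[i \in A]mem_enum -[i \in B]mem_enum AB.
Qed.

Lemma card_block_elements (A : {set 'I_n}) b :
  #|A :&: block b| = count (mem b) (elements A).
Proof.
rewrite /elements count_map -size_filter -filter_predI cardE /enum_mem -!enumT.
by congr size; apply: eq_filter => i; rewrite /= !inE andbC.
Qed.

Lemma elements_subseqs (A : {set 'I_n}) : elements A \in subseqs #|A| (iota 0 n).
Proof.
apply: subseqs_complete; last by rewrite size_map -cardE.
by rewrite -val_enum_ord map_subseq // {1}/enum_mem -enumT filter_subseq.
Qed.

Lemma profile_agree A B : agree blocks A B ->
  profile K (elements A) = profile K (elements B).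
Proof.
move=> AB; have {}AB b : b \in K ->
    count (mem b) (elements A) = count (mem b) (elements B).
  by move=> bK; rewrite -!card_block_elements; apply: AB; rewrite inE map_f.
rewrite /profile; elim: K AB => //= b K' IH AB.
by rewrite AB ?mem_head // IH // => c cK; apply: AB; rewrite inE cK orbT.
Qed.

(** Equal incidences give equal profiles, whatever the packing; that the computed
    profiles are distinct does the rest. *)
Lemma distinct_agree (s : seq (seq nat)) A B : distinct (map (profile K) s) ->
  elements A \in s -> elements B \in s -> agree blocks A B -> A = B.
Proof.
move=> /distinct_uniq us As Bs /profile_agree AB; apply: elements_inj.
exact: (uniq_map_inj us).
Qed.

Lemma triples_blocks : triples n K -> {in blocks, forall b : {set 'I_n}, #|b| = 3}.
Proof.
move=> /allP h _ /[!inE] /mapP[b /h /eqP bK ->].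
by rewrite -[block b]setTI card_block_elements /elements enum_setT -enumT val_enum_ord.
Qed.

Lemma card_blocks : #|blocks| <= size K.
Proof. by rewrite cardsE (leq_trans (card_size _)) // size_map. Qed.

Lemma has_dissociating_check : check_dissociating n K -> has_dissociating n (size K).
Proof.
case/and3P => t3 d3 d2; exists blocks; split; last exact: card_blocks.
split; first exact: triples_blocks.
  have small (A : {set 'I_n}) : #|A| <= 2 -> elements A \in
      subseqs 0 (iota 0 n) ++ subseqs 1 (iota 0 n) ++ subseqs 2 (iota 0 n).
    have := elements_subseqs A; rewrite !mem_cat.
    by case: #|A| => [|[|[|]]] //= ->; rewrite ?orbT.
  move=> A B /small A2 /small B2; apply: distinct_agree A2 B2.
  by rewrite !map_cat.
move=> A B A3 B3; apply: (distinct_agree d3).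
  by rewrite -A3 elements_subseqs.
by rewrite -B3 elements_subseqs.
Qed.

Lemma has_resolving_check : check_resolving n K -> has_resolving n (size K).
Proof.
case/and5P => t3 d3 d2 d1 /allP c; exists blocks; split; last exact: card_blocks.
split; first exact: triples_blocks.
  move=> x; have /c/hasP[b bK xb] : val x \in iota 0 n by rewrite mem_iota /= ltn_ord.
  by exists (block b); rewrite !inE // map_f.
move=> k k3 A B Ak Bk.
have [As Bs] : elements A \in subseqs k (iota 0 n) /\ elements B \in subseqs k (iota 0 n).
  by rewrite -{1}Ak -Bk !elements_subseqs.
case: k k3 {Ak Bk} As Bs (Ak) (Bk) => [|[|[|[|]]]] //= _ As Bs Ak Bk; last first.
- exact: (distinct_agree d3).
- exact: (distinct_agree d2).
- exact: (distinct_agree d1).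
by rewrite (cards0_eq Ak) (cards0_eq Bk).
Qed.

End Check.

Lemma has_dissociating_resolving n k : has_dissociating n k -> has_resolving n k.
Proof. by case=> S [sS kS]; exists S; split; first exact: dissociating_resolving. Qed.

(** * The explicit systems and their combination *)

(** The polynomial 1 + X + X^3 has no root on the unit circle, so the circulant
    incidence matrix of these triples is invertible and all sets of points have
    different incidences. *)
Definition cyclic_triples n :=
  [seq [:: i; (i + 1) %% n; (i + 3) %% n] | i <- iota 0 n].

Lemma cyclic_points n : 4 <= n <= 6 -> has_dissociating n n.
Proof.
move=> n46; have : n \in [:: 4; 5; 6] by rewrite !inE; lia.
have sizeE k : size (cyclic_triples k) = k by rewrite size_map size_iota.
rewrite !inE => /or3P[]/eqP-> {n n46}.
- by rewrite -[X in has_dissociating _ X]sizeE; apply: has_dissociating_check; vm_compute.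
- by rewrite -[X in has_dissociating _ X]sizeE; apply: has_dissociating_check; vm_compute.
- by rewrite -[X in has_dissociating _ X]sizeE; apply: has_dissociating_check; vm_compute.
Qed.

Lemma seven_points : has_dissociating 7 5.
Proof.
by apply: (@has_dissociating_check 7
  [:: [:: 0; 1; 4]; [:: 1; 3; 4]; [:: 1; 3; 5]; [:: 1; 4; 6]; [:: 2; 4; 5]]); vm_compute.
Qed.

Lemma eight_points : has_dissociating 8 6.
Proof.
by apply: (@has_dissociating_check 8
  [:: [:: 0; 1; 4]; [:: 0; 2; 6]; [:: 0; 6; 7];
      [:: 2; 4; 7]; [:: 2; 5; 6]; [:: 3; 6; 7]]); vm_compute.
Qed.

(** Points 4 and 5 together have the same incidences as point 6, so this system is
    not dissociating, and two disjoint copies of it would not resolve triples. *)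
Lemma thirteen_points : has_resolving 13 8.
Proof.
by apply: (@has_resolving_check 13
  [:: [:: 3; 10; 12]; [:: 7; 8; 10]; [:: 4; 6; 11]; [:: 0; 9; 10];
      [:: 8; 9; 12]; [:: 5; 6; 11]; [:: 2; 10; 11]; [:: 1; 7; 12]]); vm_compute.
Qed.

(** An equality case of the discharging argument.  Blocks 0 to 3 are near, the
    others are marked, with marks 0 to 11.  Points 12 and 13 join near blocks in
    pairs, 14 to 17 join a near to a marked block, 18 to 21 lie in one near and
    two marked blocks, 22 to 25 in three marked blocks; so every block spends
    exactly 39. *)
Lemma twenty_six_points : has_dissociating 26 16.
Proof.
by apply: (@has_dissociating_check 26
  [:: [:: 12; 14; 18]; [:: 12; 15; 19]; [:: 13; 16; 20]; [:: 13; 17; 21];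
   [:: 0; 14; 25]; [:: 1; 15; 25]; [:: 2; 16; 24]; [:: 3; 17; 25];
   [:: 4; 18; 23]; [:: 5; 19; 24]; [:: 6; 20; 22]; [:: 7; 21; 22];
   [:: 8; 18; 24]; [:: 9; 19; 22]; [:: 10; 20; 23]; [:: 11; 21; 23]]); vm_compute.
Qed.

Lemma has_resolving_le m k l : has_resolving m k -> k <= l -> has_resolving m l.
Proof. by move=> [S [wS kS]] kl; exists S; split; last exact: leq_trans kl. Qed.

(** Adding 26 points and 16 blocks changes q by 2, and adding 4 points changes r
    by 4 while 8 blocks are granted for 4 used.  This leaves q <= 2 with r <= 3,
    or q = 0 with 4 <= r <= 7.  The 13-point system occurs at most once in each of
    the remaining sums. *)
Lemma resolving_exists m q r : 3 < m -> m = 13 * q + r -> r < 13 ->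
  has_resolving m (8 * q + 2 * r).
Proof.
elim/ltn_ind: m q r => m IH q r m4 mE r13.
case: (leqP 3 q) => q3.
  have := IH (m - 26) _ (q - 2) r _ _ r13.
  move/(_ ltac:(lia) ltac:(lia) ltac:(lia)) => /has_resolvingD/(_ twenty_six_points).
  by rewrite subnK; [move/has_resolving_le; apply; lia | lia].
case: (boolP ((4 <= r) && (8 <= m))) => [/andP[r4 m8]|small].
  have := IH (m - 4) _ q (r - 4) _ _ _.
  move/(_ ltac:(lia) ltac:(lia) ltac:(lia) ltac:(lia)).
  move/has_resolvingD/(_ (cyclic_points (isT : 4 <= 4 <= 6))).
  by rewrite subnK; [move/has_resolving_le; apply; lia | lia].
have s7 : has_resolving 7 5 := has_dissociating_resolving seven_points.
have s8 : has_resolving 8 6 := has_dissociating_resolving eight_points.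
have s14 : has_resolving 14 10 := has_resolvingD s7 seven_points.
have s15 : has_resolving 15 11 := has_resolvingD s7 eight_points.
have s16 : has_resolving 16 12 := has_resolvingD s8 eight_points.
have s20 : has_resolving 20 13 := has_resolvingD thirteen_points seven_points.
have s27 : has_resolving 27 18 := has_resolvingD s20 seven_points.
have s28 : has_resolving 28 19 := has_resolvingD s20 eight_points.
have s21 : has_resolving 21 14 := has_resolvingD thirteen_points eight_points.
have s29 : has_resolving 29 20 := has_resolvingD s21 eight_points.
have s26 : has_resolving 26 16 := has_dissociating_resolving twenty_six_points.
have s4 : has_resolving 4 4 :=
  has_dissociating_resolving (cyclic_points (isT : 4 <= 4 <= 6)).
have s5 : has_resolving 5 5 :=
  has_dissociating_resolving (cyclic_points (isT : 4 <= 5 <= 6)).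
have s6 : has_resolving 6 6 :=
  has_dissociating_resolving (cyclic_points (isT : 4 <= 6 <= 6)).
have s13 : has_resolving 13 8 := thirteen_points.
have : m \in [:: 4; 5; 6; 7; 13; 14; 15; 16; 26; 27; 28; 29].
  by rewrite !inE; lia.
rewrite !inE.
do ?[case/orP]; move/eqP=> e; rewrite {1}e;
  match goal with H : has_resolving ?n _ |- has_resolving ?n _ =>
    by apply: (has_resolving_le H); lia end.
Qed.

(** * Orbit dimension of the action on k-subsets *)

Lemma separating_resolves (m k : nat) (S : {set {set 'I_m}}) :
  separating ('P^*)%act [set: 'S_m] (ksubsets m k) S <->
  {in S, forall b : {set 'I_m}, #|b| = k} /\ resolves k S.
Proof.
split=> [/andP[/subsetP kS /forall_inP sepS] | [kS resS]].
  split=> [b /kS|A B kA kB AB]; first by rewrite inE => /eqP.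
  have kA' : A \in ksubsets m k by rewrite inE kA.
  have kB' : B \in ksubsets m k by rewrite inE kB.
  have /forall_inP/(_ B kB')/implyP := sepS A kA'.
  case: eqVneq => //= _ /(_ isT) /exists_inP[b bS].
  by rewrite separatesE ?kA ?kB // AB ?eqxx.
apply/andP; split; first by apply/subsetP => b /kS kb; rewrite inE kb.
apply/forall_inP => A; rewrite inE => /eqP kA.
apply/forall_inP => B; rewrite inE => /eqP kB; apply/implyP => AB.
apply: contraT => /exists_inPn agr; case/eqP: AB.
apply: (resS A B kA kB) => b /agr.
by rewrite separatesE ?kA ?kB // negbK => /eqP.
Qed.

Lemma sigma_lower (m : nat) : 3 < m -> 36 * m <= 59 * sigma m 3 + 50.
Proof.
rewrite /sigma => m4; have [[S /separating_resolves[S3 resS] <-] _] :=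
  orbit_dimP ('P^*)%act [set: 'S_m]%G (ksubsets m 3).
case: (ltnP 4 m) => m5.
  have := discharging_bound S3 resS; rewrite card_ord => /(_ m5).
  by move: #|S| => s; lia.
  (* Here m = 4: no fifth point is available to pad relations between pairs,
     but distinct stars already give 4 <= 2 ^ #|S|. *)
have : #|[set: 'I_m]| <= #|powerset S|.
  rewrite -(card_imset _ (star_inj resS _)) ?card_ord // subset_leq_card //.
  apply/subsetP => _ /imsetP[v _ ->]; rewrite powersetE.
  by apply/subsetP => b /setIdP[].
rewrite cardsT card_ord card_powerset; move: #|S| => s.
by case: s => [|[|s]]; lia.
Qed.

Lemma sigma_upper (m k : nat) : has_resolving m k -> sigma m 3 <= k.
Proof.
case=> S [[S3 _ resS] kS]; apply: leq_trans kS.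
have [_] := orbit_dimP ('P^*)%act [set: 'S_m]%G (ksubsets m 3); apply.
by apply/separating_resolves; split=> //; apply: resS.
Qed.

Local Open Scope ring_scope.

Theorem theorem1p3 (m q r : nat) (hm : (4 <= m)%N)
  (hmqr : m = (13 * q + r)%N) (hr : (r < 13)%N) :
  [/\ (36 * m%:R - 50) / 59 <= (sigma m 3)%:R :> rat,
      (sigma m 3 <= 8 * q + 2 * r)%N
    & (8 * q + 2 * r)%:R <= 8 * m%:R / 13 + 24 :> rat].
Proof.
split.
- have := sigma_lower hm; rewrite -(Num.Theory.ler_nat rat) GRing.natrD !GRing.natrM.
  by move: (sigma m 3)%:R m%:R => s t; lra.
- exact: sigma_upper (resolving_exists hm hmqr hr).
have : (13 * (8 * q + 2 * r) <= 8 * m + 13 * 24)%N by lia.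
rewrite -(Num.Theory.ler_nat rat) GRing.natrD 3!GRing.natrM.
by move: (8 * q + 2 * r)%:R m%:R => s t; lra.
Qed.
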